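(* Let $Q$ be a compactly generated locally compact abelian group, $M$ an LC $Q$-module and $N$ a closed submodule of $M$. Then $\Gamma_Q(N)\subseteq\Gamma_Q(M)$.
   Context: An LC $Q$-module is an LCA group with a continuous action of $Q$ by topological automorphisms. $Q^*$ denotes the set of continuous homomorphisms $Q\to\mathbf{R}$; for $\chi\in Q^*$, $Q_\chi=\{q\in Q:\chi(q)\ge0\}$. For a submonoid $S\subseteq Q$, an LC $Q$-module $H$ is compactly generated over $S$ if there is a compact $K\subseteq H$ such that $H$ is generated as an abstract group by $\{s\cdot k:s\in S,k\in K\}$. Define $\Gamma_Q(H)=\{0\}\cup\{\chi\in Q^*: H \text{ is not compactly generated over any compactly generated submonoid of } Q_\chi\}$. *)

(* Defs.v *)
From HB Require Import structures.
From mathcomp Require Import all_boot all_order all_algebra.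
From mathcomp Require Import all_classical all_reals all_analysis.
Set Implicit Arguments. Unset Strict Implicit. Unset Printing Implicit Defensive.
Import Order.TTheory GRing.Theory Num.Theory.
Import numFieldNormedType.Exports.
Local Open Scope classical_set_scope.
Local Open Scope ring_scope.

Definition LCA (G : topologicalZmodType) : Prop :=
  hausdorff_space G /\ locally_compact [set: G].

Definition subgroup_gen (G : zmodType) (A : set G) : set G :=
  [set x | forall H : set G, H 0 -> (forall a b, H a -> H b -> H (a - b)) ->
     A `<=` H -> H x].

Definition submonoid_gen (G : zmodType) (A : set G) : set G :=
  [set x | forall H : set G, H 0 -> (forall a b, H a -> H b -> H (a + b)) ->
     A `<=` H -> H x].

Definition is_subgroup (G : zmodType) (H : set G) : Prop :=
  H 0 /\ forall a b, H a -> H b -> H (a - b).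

Definition is_submonoid (G : zmodType) (S : set G) : Prop :=
  S 0 /\ forall a b, S a -> S b -> S (a + b).

Definition compactly_generated (G : topologicalZmodType) : Prop :=
  exists K : set G, compact K /\ subgroup_gen K = [set: G].

Definition cg_submonoid (G : topologicalZmodType) (S : set G) : Prop :=
  exists K : set G, compact K /\ submonoid_gen K = S.

Definition LC_module (Q M : topologicalZmodType) (act : Q -> M -> M) : Prop :=
  [/\ LCA M,
      (forall q x y, act q (x + y) = act q x + act q y),
      (forall x, act 0 x = x),
      (forall q r x, act (q + r) x = act q (act r x)) &
      continuous (fun p : Q * M => act p.1 p.2)].

Definition closed_submodule (Q M : topologicalZmodType) (act : Q -> M -> M)
  (N : set M) : Prop :=
  [/\ closed N, is_subgroup N & forall q x, N x -> N (act q x)].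

(* The (sub)module H (a closed submodule of M, with the induced topology and
   action) is compactly generated over S: there is a compact K in H such that
   H is generated as an abstract group by {s.k : s in S, k in K}. *)
Definition cg_over (Q M : topologicalZmodType) (act : Q -> M -> M)
  (H : set M) (S : set Q) : Prop :=
  exists K : set M, compact K /\ K `<=` H /\
    subgroup_gen [set act s k | s in S & k in K] = H.

Definition dual_hom (R : realType) (Q : topologicalZmodType) (chi : Q -> R) : Prop :=
  (forall q r, chi (q + r) = chi q + chi r) /\ continuous chi.

Definition halfspace (R : realType) (Q : zmodType) (chi : Q -> R) : set Q :=
  [set q | 0 <= chi q].

Definition Gamma (R : realType) (Q M : topologicalZmodType) (act : Q -> M -> M)
  (H : set M) : set (Q -> R) :=
  [set chi | chi = (fun _ => 0) \/
    (dual_hom chi /\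
     forall S : set Q, is_submonoid S -> cg_submonoid S -> S `<=` halfspace chi ->
       ~ cg_over act H S)].

(* Main.v *)
(* If [M] is compactly generated over a compactly generated submonoid [S], then
   so is [N], over the same [S]. Since [M] has an open compactly generated
   subgroup [X], the compact generating set of [S] may be replaced by a finite
   subset [t_1, .., t_n]: modulo [X] the action on a compact set is locally
   constant. Starting from [X], adjoin the [t_i] one at a time, and prove as in
   Hilbert's basis theorem that closed invariant subgroups remain compactly
   generated, with open subgroups of leading coefficients in place of ideals.
   The base case, that a closed subgroup of a compactly generated locally
   compact abelian group is compactly generated, reduces to Dickson's lemma. *)

Require Import Defs.
From HB Require Import structures.
From mathcomp Require Import all_boot all_order all_algebra.
From mathcomp Require Import all_classical all_reals all_analysis.
Set Implicit Arguments. Unset Strict Implicit. Unset Printing Implicit Defensive.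
Import GRing.Theory.
Local Open Scope classical_set_scope.
Local Open Scope ring_scope.

(** * Dickson's lemma *)

Lemma subrACA (G : zmodType) (a b c d : G) : a - b - (c - d) = a - c - (b - d).
Proof. by rewrite !opprB addrACA [RHS]addrACA [- b - c]addrC. Qed.

Lemma finite_set_bounded_nat (T : Type) (A : set T) (c : T -> nat) :
  finite_set A -> exists h, forall x, A x -> (c x <= h)%N.
Proof.
move=> fA; have /finite_seqP[s sE] : finite_set (c @` A) by exact: finite_image.
exists (\max_(n <- s) n)%N => x Ax; have : (c @` A) (c x) by exists x.
by rewrite sE => cs; apply: leq_bigmax_seq.
Qed.

(* Dickson's lemma, for the preorder pulled back from [nat ^ m] along [c]. *)
Lemma dickson (T : Type) (c : nat -> T -> nat) (m : nat) (A : set T) :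
  exists B, [/\ finite_set B, B `<=` A &
    forall x, A x -> exists2 y, B y & forall i, (i < m)%N -> (c i y <= c i x)%N].
Proof.
elim: m A => [|m IH] A.
  have [->|/set0P[a Aa]] := eqVneq A set0.
    by exists set0; split=> //; exact: finite_set0.
  exists [set a]; split=> [|_ ->//|x _]; first exact: finite_set1.
  by exists a.
(* [B] is minimal for the first [m] coordinates and [h] bounds coordinate [m] on [B]. So [B] serves
   every [x] with [c m x >= h], and each of the finitely many slices [c m x = n] with [n < h] needs
   only the first [m] coordinates. *)
have [B [fB BA Bmin]] := IH A.
have [h hB] := finite_set_bounded_nat (c m) fB.
have /choice[D DP] n := IH (A `&` [set x | c m x = n]).
exists (B `|` \bigcup_(n in `I_h) D n); split.
- rewrite finite_setU; split=> //; apply: bigcup_finite => [|n _].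
    exact: finite_II.
  by have [] := DP n.
- by move=> x [/BA//|[n _ Dx]]; have [_ DA _] := DP n; case: (DA _ Dx).
move=> x Ax; have [xh|hx] := ltnP (c m x) h.
  have [_ DA Dmin] := DP (c m x); have [|y Dy ymin] := Dmin x; first by split.
  exists y; first by right; exists (c m x).
  move=> i; rewrite ltnS leq_eqVlt => /orP[/eqP->|/ymin//].
  by have [_ ->] := DA _ Dy.
have [y By ymin] := Bmin x Ax; exists y; first by left.
move=> i; rewrite ltnS leq_eqVlt => /orP[/eqP->|/ymin//].
exact: leq_trans (hB _ By) hx.
Qed.

(** * Finite covers, subgroups and topology *)

(** The near-covering form of compactness is applied to the filter of finite lists of indices
    directed by inclusion: all large enough lists cover [K]. *)
Lemma compact_finite_cover (T : topologicalType) (I : eqType) (K : set T)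
    (U : I -> set T) : compact K ->
    (forall x, K x -> exists i, nbhs x (U i)) ->
  exists s : seq I, forall x, K x -> exists2 i, i \in s & U i x.
Proof.
move=> /compact_near_coveringP cK KU.
pose F : set_system (seq I) :=
  [set A | exists s0 : seq I, forall s, {subset s0 <= s} -> A s].
have FF : Filter F.
  split; first by exists [::].
  - move=> A B [a aA] [b bB]; exists (a ++ b) => s abs; split.
      by apply: aA => i ia; apply: abs; rewrite mem_cat ia.
    by apply: bB => i ib; apply: abs; rewrite mem_cat ib orbT.
  - by move=> A B AB [a aA]; exists a => s /aA /AB.
have [|s0 s0P] := cK _ F (fun s x => exists2 i, i \in s & U i x) FF.
  move=> x /KU[i xU].
  exists (U i, [set s | i \in s]) => /=.
    by split=> //; exists [:: i] => s; apply; rewrite inE.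
  by move=> [y s] [/= Uy si]; exists i.
by exists s0 => x Kx; exact: s0P.
Qed.

Lemma subgroup_genP (G : zmodType) (A : set G) : is_subgroup (subgroup_gen A).
Proof.
split=> [H //|a b Ga Gb H H0 HB AH].
by apply: (HB); [apply: (Ga H)|apply: (Gb H)].
Qed.

Lemma sub_subgroup_gen (G : zmodType) (A : set G) : A `<=` subgroup_gen A.
Proof. by move=> a Aa H _ _; exact. Qed.

Lemma subgroup_gen_min (G : zmodType) (A H : set G) :
  is_subgroup H -> A `<=` H -> subgroup_gen A `<=` H.
Proof. by move=> [H0 HB] AH x; exact. Qed.

Lemma subgroupN (G : zmodType) (H : set G) x : is_subgroup H -> H x -> H (- x).
Proof. by move=> [H0 HB] Hx; rewrite -sub0r; apply: HB. Qed.

Lemma subgroupD (G : zmodType) (H : set G) x y :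
  is_subgroup H -> H x -> H y -> H (x + y).
Proof.
by move=> gH Hx Hy; rewrite -[y]opprK; apply: gH.2 => //; exact: subgroupN.
Qed.

Lemma subgroupI (G : zmodType) (H K : set G) :
  is_subgroup H -> is_subgroup K -> is_subgroup (H `&` K).
Proof.
by move=> gH gK; split=> [|a b [Ha Ka] [Hb Kb]]; split;
  [exact: gH.1|exact: gK.1|exact: gH.2|exact: gK.2].
Qed.

Lemma continuousB_zmod (T : topologicalType) (G : topologicalZmodType)
    (f g : T -> G) :
  continuous f -> continuous g -> continuous (fun x => f x - g x).
Proof.
move=> cf cg x.
apply: (@cvg_comp _ _ _ (fun y => (f y, g y)) (fun z : G * G => z.1 - z.2)
  (nbhs x) (nbhs (f x, g x))); last exact: (@sub_continuous G (f x, g x)).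
by apply: cvg_pair; [exact: cf|exact: cg].
Qed.

Lemma nbhs_subr (G : topologicalZmodType) (V : set G) (x : G) :
  nbhs 0 V -> nbhs x [set y | V (y - x)].
Proof.
move=> V0; apply: (@continuousB_zmod G G id (fun=> x)).
- by move=> y; exact: cvg_id.
- by move=> y; exact: cvg_cst.
- by rewrite subrr.
Qed.

Lemma subgroup_closed (G : topologicalZmodType) (H : set G) :
  is_subgroup H -> nbhs 0 H -> closed H.
Proof.
move=> gH H0 x clHx; have [y [Hy Hyx]] := clHx _ (nbhs_subr x H0).
by rewrite -(subKr y x); apply: gH.2 => //.
Qed.

(** * Closed subgroups of compactly generated groups *)

Lemma compact_sub (G : topologicalZmodType) (A B : set G) :
  compact A -> compact B -> compact [set x - y | x in A & y in B].
Proof.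
move=> cA cB; have -> : [set x - y | x in A & y in B] =
    [set p.1 - p.2 | p in A `*` B].
  apply/seteqP; split=> [_ [x Ax [y By <-]]|_ [[x y] [/= Ax By] <-]].
    by exists (x, y).
  by exists x => //; exists y.
apply: continuous_compact; last exact: compact_setX.
apply: continuous_subspaceT => p; exact: sub_continuous.
Qed.

(* With [K + K] covered by finitely many translates [e_i + K], each element of
   the group generated by [K] is [\sum_i z_i e_i + k] with [z] in [nat ^ m] and
   [k] in [K]. If [b] and [b'] in [B] have exponents [z >= z'], then [b - b']
   has an exponent of length at most [|z| - |z'| + 1]; hence finitely many
   minimal exponents of length at least 2 suffice to reduce all of [B]. *)
Lemma closed_subgroup_compactly_generated (G : topologicalZmodType)
    (K B : set G) :
    compact K -> nbhs 0 K -> (forall x, K x -> K (- x)) ->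
    closed B -> is_subgroup B -> B `<=` subgroup_gen K ->
  exists K', [/\ compact K', K' `<=` B &
    forall H, is_subgroup H -> K' `<=` H -> B `<=` H].
Proof.
move=> cK nK symK clB gB BK.
have [|s sP] := @compact_finite_cover G G _ (fun e => [set y | K (y - e)])
    (compact_sub cK cK).
  by move=> x _; exists x; exact: nbhs_subr.
have {}sP k k' : K k -> K k' -> exists2 e, e \in s & K (k - k' - e).
  by move=> Kk Kk'; apply: sP; exists k => //; exists k'.
pose m := size s.
pose phi (z : nat -> nat) := \sum_(i < m) s`_i *+ z i.
pose len (z : nat -> nat) := (\sum_(i < m) z i)%N.
pose bump (z : nat -> nat) j i := (z i + (i == j))%N.
have phi_bump z j : (j < m)%N -> phi (bump z j) = phi z + s`_j.
  move=> jm; rewrite /phi /bump.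
  under eq_bigr do rewrite mulrnDr.
  rewrite big_split /=; congr (_ + _).
  rewrite (bigD1 (Ordinal jm)) //= eqxx mulr1n big1 ?addr0// => i.
  by rewrite -val_eqE /= => /negbTE ->.
have len_bump z j : (j < m)%N -> len (bump z j) = (len z).+1.
  move=> jm; rewrite /len /bump big_split /= -addn1; congr addn.
  rewrite (bigD1 (Ordinal jm)) //= eqxx big1 ?addn0// => i.
  by rewrite -val_eqE /= => /negbTE ->.
have phi_small z : (len z <= 1)%N -> phi z = 0 \/ phi z \in s.
  move=> z1; have [[i zi]|z0] := pselect (exists i : 'I_m, (0 < z i)%N).
    right; move: z1; rewrite /len (bigD1 i) //= => z1.
    have zi1 : z i = 1%N.
      by apply/eqP; rewrite eqn_leq zi andbT; exact: leq_trans (leq_addr _ _) z1.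
    move: z1; rewrite zi1 addnC addn1 ltnS leqn0 sum_nat_eq0 => /forall_inP z0.
    rewrite /phi (bigD1 i) //= zi1 big1 ?addr0 ?mulr1n ?mem_nth// => j ji.
    by rewrite (eqP (z0 j ji)) mulr0n.
  left; rewrite /phi big1 // => i _.
  have [->|zi] := posnP (z i); first by rewrite mulr0n.
  by case: z0; exists i.
pose D d := exists z, K (d - phi z).
(* Since [d - phi z] and [k] lie in [K], their difference lies in some [e + K]; adding [e] to the
   exponent absorbs it. *)
have DB d k : D d -> K k -> D (d - k).
  move=> [z Kz] Kk; have [e es Ke] := sP _ _ Kz Kk.
  exists (bump z (index e s)); rewrite phi_bump ?index_mem// nth_index//.
  by rewrite opprD addrA (addrAC d).
have repr x : subgroup_gen K x -> D x.
  (* Exponents are natural numbers, so [D] is not visibly a subgroup. The translations preserving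
     [D] in both directions do form one, and it contains [K] by symmetry. *)
  move=> gx; pose H := [set x | forall d, D d -> D (d + x) /\ D (d - x)].
  have gH : is_subgroup H.
    split=> [d Dd|a b Ha Hb d Dd]; first by rewrite subr0 addr0.
    split; first by rewrite addrA; apply: (Hb _ (Ha _ Dd).1).2.
    by rewrite opprB addrA; apply: (Ha _ (Hb _ Dd).1).2.
  have KH : K `<=` H.
    move=> k Kk d Dd; split; last exact: DB.
    by rewrite -[k]opprK; apply: DB => //; exact: symK.
  have Hx := subgroup_gen_min gH KH gx.
  rewrite -[x]add0r; apply: (Hx 0 _).1.
  exists (fun=> 0%N); rewrite /phi big1 ?subr0//; exact: nbhs_singleton.
(* Dickson's lemma is applied to pairs because an element of [B] may have many exponents. Length at
   least 2 makes [|z| - |z'| + 1] smaller than [|z|]. *)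
pose A : set (G * (nat -> nat)) :=
  [set p | [/\ B p.1, K (p.1 - phi p.2) & (1 < len p.2)%N]].
have [C [fC CA Cmin]] := dickson (fun i (p : G * (nat -> nat)) => p.2 i) m A.
pose E : set G := [set 0] `|` [set` s].
have cE : compact E.
  by apply: finite_compact; rewrite finite_setU; split;
    [exact: finite_set1|exact: finite_seq].
(* The compact part contains the elements of [B] with an exponent of length at most 1; by symmetry
   of [K] it is [(E + K)] cut with [B]. The finite part performs the reductions. *)
exists ([set x - y | x in E & y in K] `&` B `|` fst @` C); split.
- apply: compactU; first by apply: compact_closedI => //; exact: compact_sub.
  by apply: finite_compact; exact: finite_image.
- by move=> x [[]//|[p /CA[Bp _ _] <-]].
move=> H gH HK b Bb; have [z Kz] := repr _ (BK _ Bb).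
have [n] := ubnP (len z); elim: n => // n IH in b z Bb Kz *.
rewrite ltnS => zn; have [z1|z1] := leqP (len z) 1.
  apply: HK; left; split=> //; exists (phi z).
    by have [->|zs] := phi_small _ z1; [left|right].
  by exists (- (b - phi z)); [exact: symK|rewrite opprK addrC subrK].
have [|[b' z'] Cp z'z] := Cmin (b, z); first by split.
have [/= Bb' Kz' z'1] := CA _ Cp.
have {}z'z (i : 'I_m) : (z' i <= z i)%N by exact: z'z.
have [e es Ke] := sP _ _ Kz Kz'.
have em : (index e s < m)%N by rewrite index_mem.
rewrite -(subrK b' b); apply: (subgroupD gH); last first.
  by apply: HK; right; exists (b', z').
apply: (IH _ (bump (fun i => z i - z' i)%N (index e s))).
- exact: gB.2.
- rewrite phi_bump // nth_index //.
  have -> : phi (fun i => z i - z' i)%N = phi z - phi z'.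
    by rewrite /phi -sumrB; apply: eq_bigr => i _; rewrite mulrnBr.
  suff -> : b - b' - (phi z - phi z' + e) = b - phi z - (b' - phi z') - e by [].
  by rewrite opprD addrA subrACA.
rewrite len_bump // {1}/len sumnB // -/(len z) -/(len z').
have le_len : (len z' <= len z)%N by apply: leq_sum => i _; exact: z'z.
apply: leq_trans zn; rewrite -[X in (_ <= X)%N](subnK le_len) -addn2.
by rewrite leq_add2l.
Qed.

Lemma subgroup_nbhs (G : topologicalZmodType) (H : set G) (x : G) :
  is_subgroup H -> nbhs 0 H -> H x -> nbhs x H.
Proof.
move=> gH nH Hx; apply: filterS (nbhs_subr x nH) => y /= Hyx.
by rewrite -(subrK x y); exact: subgroupD.
Qed.

(** * Elementary properties of the action *)

Lemma act_sub (Q M : topologicalZmodType) (act : Q -> M -> M) q x y :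
  LC_module act -> act q (x - y) = act q x - act q y.
Proof.
by case=> _ actD _ _ _; apply/eqP; rewrite eq_sym subr_eq -actD subrK.
Qed.

Lemma act_comm (Q M : topologicalZmodType) (act : Q -> M -> M) q r x :
  LC_module act -> act q (act r x) = act r (act q x).
Proof. by case=> _ _ _ actA _; rewrite -!actA addrC. Qed.

Lemma act_zero (Q M : topologicalZmodType) (act : Q -> M -> M) q :
  LC_module act -> act q 0 = 0.
Proof. by move=> LM; rewrite -(subrr 0) act_sub // !subrr. Qed.

Lemma act_continuous (Q M : topologicalZmodType) (act : Q -> M -> M) q :
  LC_module act -> continuous (act q).
Proof.
case=> _ _ _ _ cact x.
apply: (@cvg_comp _ _ _ (fun y => (q, y)) (fun p : Q * M => act p.1 p.2)
  (nbhs x) (nbhs (q, x))); last exact: (cact (q, x)).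
by apply: cvg_pair; [exact: cvg_cst|exact: cvg_id].
Qed.

(** * Hilbert's basis theorem for closed invariant subgroups *)

Definition stable_under (Q M : topologicalZmodType) (act : Q -> M -> M)
  (l : seq Q) (X : set M) : Prop :=
  forall t, t \in l -> forall x, X x -> X (act t x).

(** Generation is expressed by minimality among all stable subgroups [H], closed or not, so it is
    purely algebraic and involves no closure. *)
Definition noetherian_under (Q M : topologicalZmodType) (act : Q -> M -> M)
  (l : seq Q) (X : set M) : Prop :=
  forall N, closed N -> is_subgroup N -> stable_under act l N -> N `<=` X ->
  exists K, [/\ compact K, K `<=` N & forall H,
    is_subgroup H -> stable_under act l H -> K `<=` H -> N `<=` H].

(** This is [X + t X + .. + t ^ k X], the analogue of polynomials in [t] of degree at most [k] with
    coefficients in [X]; [Q] being additive, [t *+ k] acts as [t ^ k]. *)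
Fixpoint power_sum (Q M : topologicalZmodType) (act : Q -> M -> M) (t : Q)
    (X : set M) (k : nat) : set M :=
  if k is j.+1 then
    [set a + act (t *+ k) b | a in power_sum act t X j & b in X]
  else X.

Lemma power_sum_subgroup (Q M : topologicalZmodType) (act : Q -> M -> M) t X k :
  LC_module act -> is_subgroup X -> is_subgroup (power_sum act t X k).
Proof.
move=> LM gX; elim: k => //= k gk; split.
  exists 0; first exact: gk.1.
  by exists 0; [exact: gX.1|rewrite act_zero // addr0].
move=> _ _ [a Ya [b Xb <-]] [a' Ya' [b' Xb' <-]].
exists (a - a'); first exact: gk.2.
exists (b - b'); first exact: gX.2.
by rewrite act_sub // opprD addrACA.
Qed.

Lemma power_sum_mono (Q M : topologicalZmodType) (act : Q -> M -> M) t X j k :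
  LC_module act -> is_subgroup X -> (j <= k)%N ->
  power_sum act t X j `<=` power_sum act t X k.
Proof.
move=> LM gX /subnKC <-; elim: (k - j)%N => [|n IH]; first by rewrite addn0.
rewrite addnS => x /IH Yx; exists x => //.
by exists 0; [exact: gX.1|rewrite act_zero // addr0].
Qed.

Lemma power_sum_shift (Q M : topologicalZmodType) (act : Q -> M -> M) t X j k x :
  LC_module act -> is_subgroup X ->
  power_sum act t X k x -> power_sum act t X (k + j) (act (t *+ j) x).
Proof.
move=> LM gX; have [_ actD act0 actA _] := LM.
elim: k x => [|k IH] x /=.
  rewrite add0n; case: j => [|j] Xx; first by rewrite mulr0n act0.
  exists 0; first by case: (power_sum_subgroup t j LM gX).
  by exists x => //; rewrite add0r.
move=> [a Ya [b Xb <-]]; exists (act (t *+ j) a); first exact: IH.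
by exists b => //; rewrite actD -actA -mulrnDr [in RHS]addnC.
Qed.

Lemma power_sum_stable (Q M : topologicalZmodType) (act : Q -> M -> M) t l X k :
  LC_module act -> stable_under act l X ->
  stable_under act l (power_sum act t X k).
Proof.
move=> LM sX; elim: k => //= k IH s sl _ [a Ya [b Xb <-]].
have [_ actD _ _ _] := LM.
exists (act s a); first exact: IH.
by exists (act s b); [exact: sX|rewrite actD (act_comm s)].
Qed.

Lemma stable_under_powers (Q M : topologicalZmodType) (act : Q -> M -> M) t l H n x :
  LC_module act -> stable_under act (t :: l) H -> H x -> H (act (t *+ n) x).
Proof.
move=> [_ _ act0 actA _] sH Hx; elim: n => [|n IH].
  by rewrite mulr0n act0.
by rewrite mulrS actA; apply: sH => //; rewrite inE eqxx.
Qed.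

Lemma stable_under_behead (Q M : topologicalZmodType) (act : Q -> M -> M) t l H :
  stable_under act (t :: l) H -> stable_under act l H.
Proof. by move=> sH s sl; apply: sH; rewrite inE sl orbT. Qed.

Lemma power_sum_min (Q M : topologicalZmodType) (act : Q -> M -> M) t l X H k :
  LC_module act -> is_subgroup H -> stable_under act (t :: l) H -> X `<=` H ->
  power_sum act t X k `<=` H.
Proof.
move=> LM gH sH XH; elim: k => //= k IH _ [a /IH Ha [b /XH Hb <-]].
by apply: subgroupD => //; exact: stable_under_powers sH Hb.
Qed.

Lemma bigcup_chain_subgroup (G : zmodType) (Y : nat -> set G) :
  (forall k, is_subgroup (Y k)) ->
  (forall j k, (j <= k)%N -> Y j `<=` Y k) -> is_subgroup (\bigcup_k Y k).
Proof.
move=> gY Y_mono; split; first by exists 0%N => //; case: (gY 0%N).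
move=> a b [i _ Ya] [j _ Yb]; exists (maxn i j) => //.
by apply: (gY _).2; [apply: Y_mono Ya|apply: Y_mono Yb];
  rewrite ?leq_maxl ?leq_maxr.
Qed.

(* The argument of Hilbert's basis theorem. The open subgroups [L k N] of
   [x] in [X] for which [t ^ k.+1 x] agrees with an element of [N] up to lower
   powers of [t] play the part of the ideals of leading coefficients. *)
Lemma noetherian_under_cons (Q M : topologicalZmodType) (act : Q -> M -> M) t l X :
  LC_module act -> is_subgroup X -> stable_under act l X -> nbhs 0 X ->
  noetherian_under act l X ->
  noetherian_under act (t :: l) (\bigcup_k power_sum act t X k).
Proof.
move=> LM gX sX nX noX N clN gN sN NX; have [_ actD _ actA _] := LM.
have sNl := stable_under_behead sN.
pose Y k := power_sum act t X k.
have gY k : is_subgroup (Y k) by exact: power_sum_subgroup.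
have nY k : nbhs 0 (Y k) by apply: filterS nX; exact: (@power_sum_mono _ _ _ _ _ 0).
have sY k : stable_under act l (Y k) by exact: power_sum_stable.
pose L k H := X `&` [set x | exists2 h, H h & Y k (act (t *+ k.+1) x - h)].
have gL k H : is_subgroup H -> is_subgroup (L k H).
  move=> gH; split=> [|x y [Xx [h Hh Yh]] [Xy [h' Hh' Yh']]].
    split; first exact: gX.1.
    by exists 0; [exact: gH.1|rewrite act_zero // subr0; case: (gY k)].
  split; first exact: gX.2.
  exists (h - h'); first exact: gH.2.
  by rewrite act_sub // subrACA; exact: (gY k).2.
have sL k H : stable_under act l H -> stable_under act l (L k H).
  move=> sH s sl x [Xx [h Hh Yh]]; split; first exact: sX.
  exists (act s h); first exact: sH.
  by rewrite act_comm // -act_sub //; exact: sY.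
(* With [h = 0], [L k N] contains all [x] in [X] with [t ^ k.+1 x] in the open subgroup [Y k]. *)
have nL k : nbhs 0 (L k N).
  have nYk : nbhs 0 (act (t *+ k.+1) @^-1` Y k).
    by apply: (act_continuous LM); rewrite act_zero.
  apply: filterI => //; apply: filterS nYk => x Yx.
  by exists 0; [exact: gN.1|rewrite subr0].
have L_mono j k H : stable_under act (t :: l) H -> (j <= k)%N ->
    L j H `<=` L k H.
  move=> sH jk x [Xx [h Hh Yh]]; split=> //.
  exists (act (t *+ (k - j)) h); first exact: stable_under_powers sH Hh.
  have := power_sum_shift (k - j) LM gX Yh.
  by rewrite subnKC // act_sub // -actA -mulrnDr addnS subnK.
(* A witness [h] for one [x] also serves all points near [x], because [Y k] is open. Hence finitely
   many witnesses serve a compact generating set of [L k N]. *)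
have L_fin k : exists E, [/\ finite_set E, E `<=` N & forall H,
    is_subgroup H -> stable_under act l H -> E `<=` H ->
    L k N `<=` L k (H `&` N)].
  have [||||K [cK KL Kgen]] := noX (L k N).
  - exact: subgroup_closed (gL k N gN) (nL k).
  - exact: gL.
  - exact: sL.
  - by move=> x [].
  have [|s sP] := @compact_finite_cover M M _
      (fun h => [set x | N h /\ Y k (act (t *+ k.+1) x - h)]) cK.
    move=> x /KL[_ [h Nh Yh]]; exists h.
    have nYx : nbhs x ((fun y => act (t *+ k.+1) y - h) @^-1` Y k).
      apply: continuousB_zmod.
      - exact: act_continuous.
      - by move=> y; exact: cvg_cst.
      - exact: subgroup_nbhs.
    by apply: filterS nYx.
  exists ([set` s] `&` N); split=> [||H gH sH EH].
  - by apply: sub_finite_set (finite_seq s) => x [].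
  - by move=> x [].
  apply: Kgen.
  - by apply: gL; exact: subgroupI.
  - by apply: sL => u ul x [Hx Nx]; split; [exact: sH|exact: sNl].
  - move=> x Kx; have [h hs [Nh Yh]] := sP _ Kx; split; first by case: (KL _ Kx).
    by exists h => //; split=> //; exact: EH.
(* The leading coefficient [b] of [x] lies in [L k N], hence is shared by some [h] in both [H] and
   [N]; then [x - h] has degree at most [k]. *)
have reduce k H x : is_subgroup H -> L k N `<=` L k (H `&` N) ->
    N `&` Y k `<=` H -> N x -> Y k.+1 x -> H x.
  move=> gH LH NH Nx [a Ya [b Xb xE]].
  have [|_ [h [Hh Nh] Yh]] := LH b.
    split=> //; exists x => //; rewrite -xE opprD addrC subrK.
    exact: subgroupN.
  rewrite -(subrK h x); apply: subgroupD => //; apply: NH; split.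
    exact: gN.2.
  by rewrite -xE -addrA; exact: subgroupD.
have fin n : exists K, [/\ compact K, K `<=` N & forall H,
    is_subgroup H -> stable_under act (t :: l) H -> K `<=` H ->
    N `&` Y n `<=` H].
  elim: n => [|n [K [cK KN Kgen]]].
    have [||||K [cK KN Kgen]] := noX (N `&` X).
    - by apply: closedI => //; exact: subgroup_closed.
    - exact: subgroupI.
    - by move=> u ul x [Nx Xx]; split; [exact: sNl|exact: sX].
    - by move=> x [].
    exists K; split=> // [x /KN[]//|H gH sH KH].
    by apply: Kgen => //; exact: stable_under_behead sH.
  have [E [fE EN Egen]] := L_fin n.
  exists (K `|` E); split=> [|x []|H gH sH KEH x [Nx Yx]].
  - by apply: compactU => //; exact: finite_compact.
  - exact: KN.
  - exact: EN.
  apply: (reduce n) => //.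
    apply: Egen => // [|e Ee]; first exact: stable_under_behead sH.
    by apply: KEH; right.
  by apply: Kgen => // y Ky; apply: KEH; left.
have gU : is_subgroup (\bigcup_k L k N).
  by apply: bigcup_chain_subgroup => [k|j k]; [exact: gL|exact: L_mono].
(* The chain [L k N] stabilises: its union is generated by a compact set, which is covered by
   finitely many of the open subgroups [L k N]. *)
have [k0 k0P] : exists k0, forall k, L k N `<=` L k0 N.
  have [||||K [cK KU Kgen]] := noX (\bigcup_k L k N).
  - by apply: subgroup_closed => //; apply: filterS (nL 0%N) => x; exists 0%N.
  - exact: gU.
  - by move=> u ul x [k _ Lx]; exists k => //; exact: sL.
  - by move=> x [k _ []].
  have [|s sP] := @compact_finite_cover M nat _ (fun k => L k N) cK.
    move=> x /KU[k _ Lx]; exists k; exact: subgroup_nbhs (gL k N gN) (nL k) Lx.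
  exists (\max_(k <- s) k)%N => k x Lx.
  apply: (Kgen (L (\max_(k <- s) k)%N N)); last by exists k.
  - exact: gL.
  - exact: sL.
  move=> y Ky; have [j js] := sP _ Ky; apply: L_mono => //.
  exact: leq_bigmax_seq.
have [K [cK KN Kgen]] := fin k0; have [E [fE EN Egen]] := L_fin k0.
exists (K `|` E); split=> [|x []|H gH sH KEH x Nx].
- by apply: compactU => //; exact: finite_compact.
- exact: KN.
- exact: EN.
have [n _] := NX _ Nx; rewrite -/(Y n).
elim: n => [|n IH] in x Nx *.
  move=> Yx; apply: (Kgen H) => // [y Ky|]; first by apply: KEH; left.
  by split=> //; apply: power_sum_mono Yx.
move=> Yx; have [nk0|k0n] := ltnP n k0.
  apply: (Kgen H) => // [y Ky|]; first by apply: KEH; left.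
  by split=> //; apply: power_sum_mono Yx.
(* In degree [n.+1] with [n >= k0], the coefficient passes from [L n N] to [L k0 N], then by [E] to
   [L k0 (H]&[N)], and back up to level [n] by multiplying with a power of [t]. *)
apply: (reduce n) => // [b /k0P Lb|y [Ny Yy]]; last exact: IH.
apply: (L_mono k0) => //.
  by move=> u ul y [Hy Ny]; split; [exact: sH|exact: sN].
apply: Egen Lb => // [|e Ee]; first exact: stable_under_behead sH.
by apply: KEH; right.
Qed.

(** Induction on [l], each new element being adjoined by the basis theorem; [X] stays open because
    it contains [K]. Its minimality is used later to make it stable under the whole compact set
    [P]. *)
Lemma noetherian_under_generated (Q M : topologicalZmodType) (act : Q -> M -> M)
    (K : set M) (l : seq Q) :
    LC_module act -> compact K -> nbhs 0 K -> (forall x, K x -> K (- x)) ->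
  exists X, [/\ is_subgroup X, stable_under act l X, K `<=` X,
    noetherian_under act l X & forall H, is_subgroup H ->
      stable_under act l H -> K `<=` H -> X `<=` H].
Proof.
move=> LM cK nK symK; elim: l => [|t l [X [gX sX KX noX Xmin]]].
  exists (subgroup_gen K); split=> //.
  - exact: subgroup_genP.
  - exact: sub_subgroup_gen.
  - move=> N clN gN _ NK.
    have [K' [cK' K'N gen]] :=
      closed_subgroup_compactly_generated cK nK symK clN gN NK.
    by exists K'; split=> // H gH _; exact: gen.
  - by move=> H gH _; exact: subgroup_gen_min.
have nX : nbhs 0 X by exact: filterS nK.
exists (\bigcup_k power_sum act t X k); split.
- apply: bigcup_chain_subgroup => [k|j k]; first exact: power_sum_subgroup.
  exact: power_sum_mono.
- move=> s; rewrite inE => /predU1P[->|sl] x [k _ Yx].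
    by exists (k + 1)%N => //; rewrite -[t]mulr1n; exact: power_sum_shift.
  by exists k => //; exact: power_sum_stable sl _ Yx.
- by move=> x /KX; exists 0%N.
- exact: noetherian_under_cons.
- move=> H gH sH KH x [k _]; apply: (power_sum_min LM gH sH).
  by apply: Xmin => //; exact: stable_under_behead sH.
Qed.

(** * Reduction to finitely many operators, and conclusion *)

(** The difference [act p k - act p0 k] is jointly continuous and vanishes at [p = p0], so by
    compactness of [K] it is in [V] for all [k] in [K] at once when [p] is near [p0]. Compactness of
    [P] then leaves finitely many [p0]. *)
Lemma compact_act_finite (Q M : topologicalZmodType) (act : Q -> M -> M)
    (P : set Q) (K V : set M) :
    LC_module act -> compact P -> compact K -> nbhs 0 V ->
  exists l : seq Q, [set` l] `<=` P /\
    forall p, P p -> exists2 f, f \in l & forall k, K k -> V (act p k - act f k).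
Proof.
move=> LM cP /compact_near_coveringP cK nV; have [_ _ _ _ cact] := LM.
have [|s sP] := @compact_finite_cover Q Q _
    (fun f => [set p | P f /\ K `<=` [set k | V (act p k - act f k)]]) cP.
  move=> p0 Pp0; exists p0.
  have : \forall p \near p0, K `<=` [set k | V (act p k - act p0 k)].
    apply: (cK _ (nbhs p0) (fun p k => V (act p k - act p0 k))) => k Kk.
    have cB : continuous (fun z : M * Q => act z.2 z.1 - act p0 z.1).
      apply: continuousB_zmod => z.
        apply: (@cvg_comp _ _ _ (fun z : M * Q => (z.2, z.1))
          (fun p : Q * M => act p.1 p.2) (nbhs z) (nbhs (z.2, z.1))).
          by apply: cvg_pair; [exact: cvg_snd|exact: cvg_fst].
        exact: (cact (z.2, z.1)).
      apply: (@cvg_comp _ _ _ (fun z : M * Q => z.1) (act p0)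
        (nbhs z) (nbhs z.1)); first exact: cvg_fst.
      exact: act_continuous.
    by apply: (cB (k, p0)); rewrite /= subrr.
  by apply: filterS => p.
exists [seq f <- s | `[< P f >]]; split.
  by move=> f /=; rewrite mem_filter => /andP[/asboolP].
move=> p /sP[f fs [Pf Kf]]; exists f => //.
by rewrite mem_filter fs andbT; apply/asboolP.
Qed.

Lemma compact_symmetric_nbhs0 (G : topologicalZmodType) (K : set G) :
  LCA G -> compact K ->
  exists K', [/\ compact K', nbhs 0 K', K `<=` K' & forall x, K' x -> K' (- x)].
Proof.
move=> [_ lcG] cK; have [U] := lcG 0 I.
rewrite withinET => nU [cU _].
pose A := K `|` U; have cA : compact A by exact: compactU.
exists (A `|` -%R @` A); split.
- apply: compactU => //; apply: continuous_compact => //.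
  by apply: continuous_subspaceT => x; exact: opp_continuous.
- by apply: filterS nU => x Ux; left; right.
- by move=> x Kx; left; left.
- move=> x [Ax|[y Ay <-]]; first by right; exists x.
  by left; rewrite opprK.
Qed.

Lemma cg_over_closed_submodule (Q M : topologicalZmodType) (act : Q -> M -> M)
    (N : set M) (S : set Q) :
    LC_module act -> closed_submodule act N -> cg_submonoid S ->
  cg_over act [set: M] S -> cg_over act N S.
Proof.
move=> LM [clN gN sN] [P [cP <-]] [K0 [cK0 [_ genM]]].
have [LCM actD act0 actA _] := LM.
have [K [cK nK K0K symK]] := compact_symmetric_nbhs0 LCM cK0.
have nK_gen : nbhs 0 (subgroup_gen K).
  by apply: filterS nK; exact: sub_subgroup_gen.
have [l [lP lgen]] := compact_act_finite LM cP cK nK_gen.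
have [X [gX sX KX noX Xmin]] := noetherian_under_generated l LM cK nK symK.
(* By minimality of [X] it suffices that its preimage under [p] is an [l]-stable subgroup, by
   commutativity of [Q], and contains [K], as [p k] differs from some [f k] by an element of the
   group generated by [K]. *)
have PX p : P p -> X `<=` [set x | X (act p x)].
  move=> Pp; apply: Xmin.
  - split=> [|x y Xx Xy] /=; first by rewrite act_zero //; exact: gX.1.
    by rewrite act_sub //; exact: gX.2.
  - by move=> f fl x /= Xx; rewrite act_comm //; exact: sX.
  - move=> k Kk /=; have [f fl fP] := lgen _ Pp.
    rewrite -(subrK (act f k) (act p k)); apply: subgroupD => //.
      by apply: (subgroup_gen_min gX KX); exact: fP.
    by apply: sX => //; exact: KX.
(* The [q] mapping [X] into itself form a submonoid containing [P], hence all of [S]. *)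
have XT : X = [set: M].
  apply/seteqP; split=> // x _; have : [set: M] x by [].
  rewrite -genM; apply: subgroup_gen_min => // _ [s Ss [k /K0K/KX Xk <-]].
  apply: (Ss [set q | X `<=` [set x | X (act q x)]]) Xk => //.
  - by move=> y Xy /=; rewrite act0.
  - by move=> q r qX rX y /rX /qX /=; rewrite actA.
have [||K' [cK' K'N K'gen]] := noX N clN gN.
- by move=> t _ x; exact: sN.
- by rewrite XT.
exists K'; split=> //; split=> //; apply/seteqP; split.
  by apply: subgroup_gen_min => // _ [s _ [k /K'N Nk <-]]; exact: sN.
(* The group generated by the [S]-translates of [K'] is [l]-stable because [l] consists of elements
   of [P], so [f + s] stays in [S]. *)
apply: K'gen; first exact: subgroup_genP.
- move=> f fl x gx.
  apply: (subgroup_gen_min (H := [set x | subgroup_gen _ (act f x)])) gx.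
    split=> [|a b ga gb] /=; first by rewrite act_zero //; exact: (subgroup_genP _).1.
    by rewrite act_sub //; exact: (subgroup_genP _).2.
  move=> _ [s Ss [k K'k <-]] /=; rewrite -actA; apply: sub_subgroup_gen.
  exists (f + s); last by exists k.
  move=> H H0 HD PH; apply: (HD); last exact: Ss.
  by apply: PH; exact: lP.
- move=> k K'k; apply: sub_subgroup_gen; exists 0; first by move=> H.
  by exists k.
Qed.

Theorem mainTheorem18 (R : realType) (Q M : topologicalZmodType)
  (act : Q -> M -> M) (N : set M) :
  LCA Q -> compactly_generated Q ->
  LC_module act -> closed_submodule act N ->
  @Gamma R Q M act N `<=` @Gamma R Q M act [set: M].
Proof.
move=> _ _ LM sN chi [->|[hom_chi notcg]]; first by left.
right; split=> // S mS cgS Schi cgM; apply: (notcg S) => //.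
exact: cg_over_closed_submodule cgM.
Qed.
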